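(* Let $(X,\delta_X)$ and $(Y,\delta_Y)$ be finite isomorphic ordinal spaces. Then the Hasse diagrams $\mathcal H(\mathbf B_X)$ and $\mathcal H(\mathbf B_Y)$ of the posets $(\mathbf B_X,\subseteq)$ and $(\mathbf B_Y,\subseteq)$ are isomorphic as directed graphs.
   Context: An ordinal space is an ordered triplet $(X,L,\delta)$, also written $(X,\delta)$, where $X$ is a set, $L$ is a linearly ordered set with minimal element $0$, and $\delta\colon X\times X\to L$ is a surjective mapping such that for all $x,y\in X$: (i) $\delta(x,y)=\delta(y,x)$; (ii) $\delta(x,y)=0$ if and only if $x=y$. It is finite if $X$ is finite. Ordinal spaces $(X,\delta_X)$ and $(Y,\delta_Y)$ are isomorphic if there exists a bijection $\Phi\colon X\to Y$ such that for all $x,y,z,w\in X$ the comparison ($<$, $=$ or $>$) of $\delta_X(x,y)$ with $\delta_X(z,w)$ is the same as the comparison of $\delta_Y(\Phi(x),\Phi(y))$ with $\delta_Y(\Phi(z),\Phi(w))$. A cut $(A,B)$ of a linearly ordered set $S$ is a pair with $S=A\cup B$ such that each element of $A$ is less than each element of $B$. For $c\in X$ let $\operatorname{Sp}(c)=\{\delta(c,x)\mid x\in X\}\subseteq L$. A ball at the point $c$ is a set of the form $\{x\in X\mid\delta(c,x)\in A\}$, where $(A,B)$ is a cut of $\operatorname{Sp}(c)$ with $A\neq\varnothing$. $\mathbf B_X$ denotes the set of all balls (at all points) of $X$, partially ordered by inclusion. The Hasse diagram $\mathcal H(P)$ of a finite poset $(P,\leqslant)$ is the directed graph with vertex set $P$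 and with an arc $\langle u,v\rangle$ if and only if $u\leqslant v$, $u\neq v$, and for every $w\in P$, $u\leqslant w\leqslant v$ implies $w=u$ or $w=v$. Directed graphs $(V,A_V)$ and $(W,A_W)$ are isomorphic if there is a bijection $F\colon V\to W$ with $\langle x,y\rangle\in A_V\Leftrightarrow\langle F(x),F(y)\rangle\in A_W$. *)

(* Defs.v *)
From HB Require Import structures.
From mathcomp Require Import all_boot all_order.
From mathcomp Require Import boolp classical_sets cardinality.

Set Implicit Arguments.
Unset Strict Implicit.
Unset Printing Implicit Defensive.

Import Order.TTheory.
Local Open Scope order_scope.
Local Open Scope classical_set_scope.

(* The minimal element 0 of L is the bottom element \bot of a [bOrderType]. *)
Record ordinalSpace (d : Order.disp_t) := OrdinalSpace {
  carrier :> Type;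
  scale : bOrderType d;
  delta : carrier -> carrier -> scale;
  delta_surj : forall l : scale, exists x y : carrier, delta x y = l;
  delta_sym : forall x y : carrier, delta x y = delta y x;
  delta_eq0 : forall x y : carrier, delta x y = \bot <-> x = y
}.

Definition finite_space (d : Order.disp_t) (X : ordinalSpace d) : Prop :=
  finite_set [set: X].

Definition same_comparison (d d' : Order.disp_t)
    (L : porderType d) (L' : porderType d') (a b : L) (a' b' : L') : Prop :=
  [/\ a < b <-> a' < b', a = b <-> a' = b' & a > b <-> a' > b'].

Definition space_isomorphic (d d' : Order.disp_t)
    (X : ordinalSpace d) (Y : ordinalSpace d') : Prop :=
  exists Phi : X -> Y, bijective Phi /\
    forall x y z w : X,
      same_comparison (delta x y) (delta z w)
        (delta (Phi x) (Phi y)) (delta (Phi z) (Phi w)).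

Definition is_cut (d : Order.disp_t) (L : porderType d) (S A B : set L) : Prop :=
  S = A `|` B /\ forall a b : L, A a -> B b -> a < b.

Definition Sp (d : Order.disp_t) (X : ordinalSpace d) (c : X) : set (scale X) :=
  [set delta c x | x in [set: X]].

Definition is_ball_at (d : Order.disp_t) (X : ordinalSpace d) (c : X)
    (U : set X) : Prop :=
  exists A B : set (scale X),
    [/\ is_cut (Sp c) A B, A !=set0 & U = [set x | A (delta c x)]].

Definition balls (d : Order.disp_t) (X : ordinalSpace d) : set (set X) :=
  [set U | exists c : X, is_ball_at c U].
Arguments balls {d} X.

Definition ball_poset (d : Order.disp_t) (X : ordinalSpace d) : Type :=
  set_type (balls X).

(* The order is the one inherited from [set X], that is, inclusion. *)
HB.instance Definition _ (d : Order.disp_t) (X : ordinalSpace d) :=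
  SubChoice.on (ball_poset X).
HB.instance Definition _ (d : Order.disp_t) (X : ordinalSpace d) :=
  [SubChoice_isSubPOrder of ball_poset X by <: with set_display].

Lemma ball_leE (d : Order.disp_t) (X : ordinalSpace d) (U V : ball_poset X) :
  (U <= V) = (val U `<=` val V) :> Prop.
Proof. by rewrite -subsetEset. Qed.

Record digraph := Digraph {
  vertex : Type;
  darc : vertex -> vertex -> Prop
}.

Definition digraph_isomorphic (G H : digraph) : Prop :=
  exists F : vertex G -> vertex H, bijective F /\
    forall x y : vertex G, darc x y <-> darc (F x) (F y).

Definition hasse (d : Order.disp_t) (P : porderType d) : digraph :=
  @Digraph P (fun u v : P =>
    [/\ u <= v, u <> v & forall w : P, u <= w -> w <= v -> w = u \/ w = v]).

(* Main.v *)
Require Import Defs.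
From mathcomp Require Import all_boot all_order.
From mathcomp Require Import boolp classical_sets.

Set Implicit Arguments.
Unset Strict Implicit.
Unset Printing Implicit Defensive.

Import Order.TTheory.
Local Open Scope order_scope.
Local Open Scope classical_set_scope.

(** Being a ball only depends on how distances compare: a cut of the spectrum
    of a point is determined by which points lie on its lower side, and the
    condition that it is a cut only speaks of inequalities between distances.
    Hence pulling back along an isomorphism of ordinal spaces carries balls to
    balls ([is_ball_at_preimage]).  Pulling back along the inverse isomorphism
    undoes this, and both maps are monotone for inclusion, so the two posets of
    balls are order isomorphic.  As the covering relation is defined from the
    order alone, an order isomorphism is an isomorphism of Hasse diagrams
    ([hasse_isomorphic]). *)

Lemma hasse_isomorphic (d d' : Order.disp_t) (P : porderType d)
    (Q : porderType d') (F : P -> Q) :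
  bijective F -> {mono F : u v / u <= v} ->
  digraph_isomorphic (hasse P) (hasse Q).
Proof.
move=> bijF leF; exists F; split=> // u v /=.
have injF := bij_inj bijF; have [G _ GK] := bijF.
split=> -[leuv neuv cov]; split.
- by rewrite leF.
- by move/injF.
- move=> w; rewrite -(GK w) !leF => leu lev.
  by have [->|->] := cov _ leu lev; [left|right].
- by rewrite -leF.
- by move=> equv; apply: neuv; rewrite equv.
- move=> w leu lev.
  by have [||/injF|/injF] := cov (F w); rewrite ?leF //; [left|right].
Qed.

Definition comparison_preserving (dX dY : Order.disp_t)
    (X : ordinalSpace dX) (Y : ordinalSpace dY) (f : X -> Y) : Prop :=
  forall x y z w : X,
    same_comparison (delta x y) (delta z w)
      (delta (f x) (f y)) (delta (f z) (f w)).

Lemma comparison_preserving_inverse (dX dY : Order.disp_t)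
    (X : ordinalSpace dX) (Y : ordinalSpace dY) (f : X -> Y) (g : Y -> X) :
  cancel g f -> comparison_preserving f -> comparison_preserving g.
Proof.
move=> gK cmpf x y z w.
have := cmpf (g x) (g y) (g z) (g w); rewrite !gK => -[ltE eqE gtE].
by split; apply: iff_sym.
Qed.

(** A cut [(A, B)] of the spectrum of [f c] is transported by collecting the
    distances from [c] to the points that [f] sends to the [A]-side,
    respectively the [B]-side.  Surjectivity of [f] serves to keep the lower
    class nonempty. *)
Lemma is_ball_at_preimage (dX dY : Order.disp_t)
    (X : ordinalSpace dX) (Y : ordinalSpace dY) (f : X -> Y) (c : X)
    (U : set Y) :
  (forall y, exists x, f x = y) -> comparison_preserving f ->
  is_ball_at (f c) U -> is_ball_at c (f @^-1` U).
Proof.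
move=> surjf cmpf [A [B [[SpE ltAB] [a Aa] ->]]].
have SpAB x : A (delta (f c) (f x)) \/ B (delta (f c) (f x)).
  have : Sp (f c) (delta (f c) (f x)) by exists (f x).
  by rewrite SpE.
pose pull (S : set (scale Y)) : set (scale X) :=
  [set delta c x | x in [set x | S (delta (f c) (f x))]].
exists (pull A), (pull B); split.
- split.
  + apply/seteqP; split=> [_ [x _ <-]|_ [[x _ <-]|[x _ <-]]]; try by exists x.
    by have [Ax|Bx] := SpAB x; [left|right]; exists x.
  + move=> _ _ [x Ax <-] [y By <-].
    by have [[_ lt_of] _ _] := cmpf c x c y; apply/lt_of/ltAB.
- have : Sp (f c) a by rewrite SpE; left.
  move=> [y _ ya]; have [x xy] := surjf y.
  by exists (delta c x), x; rewrite //= xy ya.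
- apply/seteqP; split=> x /= => [Ax|[x' Ax' eqx]]; first by exists x.
  (* Two points at equal distance from [c] are on the same side. *)
  by have [_ [eq_of _] _] := cmpf c x' c x; rewrite -(eq_of eqx).
Qed.

Lemma balls_preimage (dX dY : Order.disp_t)
    (X : ordinalSpace dX) (Y : ordinalSpace dY) (f : X -> Y) (U : set Y) :
  (forall y, exists x, f x = y) -> comparison_preserving f ->
  balls Y U -> balls X (f @^-1` U).
Proof.
move=> surjf cmpf [c' ballU]; have [c cE] := surjf c'.
by exists c; apply: is_ball_at_preimage; rewrite // cE.
Qed.

Theorem proposition5p2 (dX dY : Order.disp_t)
    (X : ordinalSpace dX) (Y : ordinalSpace dY)
    (finX : finite_space X) (finY : finite_space Y)
    (isoXY : space_isomorphic X Y) :
  digraph_isomorphic (hasse (ball_poset X)) (hasse (ball_poset Y)).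
Proof.
have [f [[g fK gK] cmpf]] := isoXY.
have cmpg : comparison_preserving g := comparison_preserving_inverse gK cmpf.
have ballf (V : ball_poset Y) : f @^-1` val V \in balls X.
  apply/mem_set/balls_preimage => //; first by move=> y; exists (g y).
  exact/set_mem/(valP V).
have ballg (U : ball_poset X) : g @^-1` val U \in balls Y.
  apply/mem_set/balls_preimage => //; first by move=> x; exists (f x).
  exact/set_mem/(valP U).
pose F U : ball_poset Y := Sub (g @^-1` val U) (ballg U).
pose G V : ball_poset X := Sub (f @^-1` val V) (ballf V).
apply: (@hasse_isomorphic _ _ _ _ F).
  exists G => [U|V]; apply: val_inj; rewrite !SubK; apply/seteqP.
  - by split=> x /=; rewrite fK.
  - by split=> y /=; rewrite gK.
move=> U V; apply/is_true_inj/propext; rewrite !ball_leE SubK.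
split=> [leUV x Ux|leUV y]; last exact: leUV.
by have := leUV (f x); rewrite /= fK; apply.
Qed.
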